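(* Consider the linear network $x(t+1)=Ax(t)+Bu(t)$ with block-diagonal $K$, $A_K=A+BK$, $W_i(\xi_i)=\xi_i^\top P_i\xi_i$ with $P_i=P_i^\top\succ0$, $M\in\mathbb N$, as in the context. Fix $i$ and let $\Phi_i(M)=[\Phi_{i1}(M)\ \cdots\ \Phi_{i\ell}(M)]$ be the $i$-th block row of $A_K^M$. Fix $a_{ij}>0$ for every $j$ with $\Phi_{ij}(M)\ne0$, put $a_{ij}=0$ otherwise, and $\gamma_{ij}(s)=a_{ij}s$. If there exist $\tau_{ij}\ge0$, $j=1,\dots,\ell$, such that $$\Phi_i(M)^\top P_i\Phi_i(M)\preceq\operatorname{blkdiag}(\tau_{i1}P_1,\dots,\tau_{i\ell}P_\ell),\qquad\sum_{j:\,\Phi_{ij}(M)\neq0}\frac{\tau_{ij}}{a_{ij}}\le1,$$ then for every $\xi\in\mathbb R^n$ $$W_i\bigl(x_i(M,\xi,q)\bigr)\le\max_{j=1,\dots,\ell}\gamma_{ij}\bigl(W_j(\xi_j)\bigr),$$ where $x(l,\xi,q)=A_K^l\xi$. For fixed $P_i,K,M,a_{ij}$, the two conditions form a semidefinite feasibility problem in $(\tau_{ij})_j$ (i.e. they are linear matrix inequalities and linear inequalities in $\tau_{ij}$).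
   Context: $x=(x_1,\dots,x_\ell)\in\mathbb R^n$ with blocks $x_i\in\mathbb R^{n_i}$, $A=[A_{ij}]_{i,j=1}^\ell$, $B=\operatorname{blkdiag}(B_1,\dots,B_\ell)$, $K=\operatorname{blkdiag}(K_1,\dots,K_\ell)$. $A_K^M=[\Phi_{ij}(M)]_{i,j=1}^\ell$ is the block partition of the $M$-th power. $x(\cdot,\xi,q)$ is the trajectory generated from $\xi$ by the finite-step feedback $q(\xi)=(K\xi,KA_K\xi,\dots,KA_K^{M-1}\xi)$. $\preceq$ is the Loewner order. *)

(* Defs.v *)
From mathcomp Require Import all_boot all_order all_algebra.
From mathcomp Require Import reals.

Set Implicit Arguments.
Unset Strict Implicit.
Unset Printing Implicit Defensive.

Import Order.TTheory GRing.Theory Num.Theory.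

Local Open Scope ring_scope.

Definition qform (R : realType) (k : nat) (P : 'M[R]_k) (x : 'cV[R]_k) : R :=
  (x^T *m P *m x) 0 0.

Definition posdef (R : realType) (k : nat) (P : 'M[R]_k) : Prop :=
  P^T = P /\ forall x : 'cV[R]_k, x != 0 -> 0 < qform P x.

Definition possemidef (R : realType) (k : nat) (P : 'M[R]_k) : Prop :=
  P^T = P /\ forall x : 'cV[R]_k, 0 <= qform P x.

Definition loewner (R : realType) (k : nat) (S T : 'M[R]_k) : Prop :=
  possemidef (T - S).

(* The library's [\mxdiag] requires square diagonal blocks; this is the same
   construction for rectangular ones. *)
Definition blkdiag (R : realType) (ell : nat) (p q : 'I_ell -> nat)
    (B : forall i, 'M[R]_(p i, q i)) :
    'M[R]_((\sum_i p i)%N, (\sum_i q i)%N) :=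
  \mxblock_(i < ell, j < ell) (if i == j then conform_mx 0 (B i) else 0).

(* Inputs beyond the end of the control sequence [u] are read as 0, so only the
   values at times [t <= size u] are meaningful. *)
Fixpoint trajectory (R : realType) (n m : nat) (A : 'M[R]_n) (B : 'M[R]_(n, m))
    (xi : 'cV[R]_n) (u : seq 'cV[R]_m) (t : nat) : 'cV[R]_n :=
  if t is s.+1 then A *m trajectory A B xi u s + B *m nth 0 u s else xi.

Definition finite_step_feedback (R : realType) (n m M : nat) (AK : 'M[R]_n)
    (K : 'M[R]_(m, n)) (xi : 'cV[R]_n) : M.-tuple 'cV[R]_m :=
  [tuple K *m AK ^+ k *m xi | k < M].

(* [F0] and the [F j] are symmetric, as in the standard form
   F0 + t_1 F_1 + ... + t_k F_k >= 0 of a linear matrix inequality in t. *)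
Definition linear_matrix_inequality (R : realType) (k : nat)
    (C : ('I_k -> R) -> Prop) : Prop :=
  exists (N : nat) (F0 : 'M[R]_N) (F : 'I_k -> 'M[R]_N),
    [/\ F0^T = F0,
        forall j, (F j)^T = F j &
        forall t, C t <-> loewner 0 (F0 + \sum_(j < k) t j *: F j)].

Definition linear_inequality (R : realType) (k : nat)
    (C : ('I_k -> R) -> Prop) : Prop :=
  exists (c : 'I_k -> R) (d : R),
    forall t, C t <-> \sum_(j < k) c j * t j <= d.

Definition semidefinite_feasibility (R : realType) (k : nat)
    (C : ('I_k -> R) -> Prop) : Prop :=
  exists (r s : nat) (G : 'I_r -> ('I_k -> R) -> Prop)
      (H : 'I_s -> ('I_k -> R) -> Prop),
    [/\ forall a, linear_matrix_inequality (G a),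
        forall b, linear_inequality (H b) &
        forall t, C t <-> (forall a, G a t) /\ (forall b, H b t)].

(* Main.v *)
(** Blocks of [xi] that [Phi_i] annihilates can be set to zero without changing
    [Phi_i xi]. Evaluating the matrix inequality at the truncated vector bounds
    [W_i] by the sum of [tau_j W_j = (tau_j / a_j) gamma_j (W_j)] over the blocks
    with [Phi_ij != 0] only; the weights are nonnegative of total mass at most 1,
    so the sum is at most the (nonnegative) maximum of the [gamma_j (W_j)]. *)

Require Import Defs.
From mathcomp Require Import all_boot all_order all_algebra.
From mathcomp Require Import reals.

Import Order.TTheory GRing.Theory Num.Theory.

Local Open Scope ring_scope.

Section QuadraticForms.
Variables (R : realType).

Lemma qform0 k (P : 'M[R]_k) : qform P 0 = 0.
Proof. by rewrite /qform mulmx0 mxE. Qed.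

Lemma qformZ k (c : R) (P : 'M[R]_k) x : qform (c *: P) x = c * qform P x.
Proof. by rewrite /qform -scalemxAr -scalemxAl mxE. Qed.

Lemma qformB k (P Q : 'M[R]_k) x : qform (P - Q) x = qform P x - qform Q x.
Proof. by rewrite /qform mulmxBr mulmxBl !mxE. Qed.

Lemma qform_mulmx k l (P : 'M[R]_k) (F : 'M[R]_(k, l)) x :
  qform P (F *m x) = qform (F^T *m P *m F) x.
Proof. by rewrite /qform trmx_mul !mulmxA. Qed.

Lemma qform_mxdiag ell (p : 'I_ell -> nat) (D : forall j, 'M[R]_(p j))
    (C : forall j, 'cV[R]_(p j)) :
  qform (\mxdiag_j D j) (\mxcol_j C j) = \sum_j qform (D j) (C j).
Proof.
rewrite /qform -mulmxA mul_mxdiag_mxcol tr_mxcol mul_mxrow_mxcol summxE.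
by apply: eq_bigr => j _; rewrite mulmxA.
Qed.

Lemma posdef_ge0 k (P : 'M[R]_k) x : posdef P -> 0 <= qform P x.
Proof.
case=> _ Ppos; have [-> | /Ppos/ltW //] := eqVneq x 0.
by rewrite qform0.
Qed.

Lemma loewner_qform k (S T : 'M[R]_k) x :
  loewner S T -> qform S x <= qform T x.
Proof. by case=> _ /(_ x); rewrite qformB subr_ge0. Qed.

(** The sum skips the zero blocks because the scalar condition bounds [tau j / a j] only where
    [F j != 0]; elsewhere [tau j] may be large while [a j] is 0. *)
Lemma qform_mxrow_le k ell (p : 'I_ell -> nat) (F : forall j, 'M[R]_(k, p j))
    (Q : 'M[R]_k) (P : forall j, 'M[R]_(p j)) (tau : 'I_ell -> R)
    (xi : forall j, 'cV[R]_(p j)) :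
  loewner ((\mxrow_j F j)^T *m Q *m \mxrow_j F j)
    (\mxdiag_j (tau j *: P j)) ->
  qform Q (\mxrow_j F j *m \mxcol_j xi j)
    <= \sum_(j | F j != 0) tau j * qform (P j) (xi j).
Proof.
pose y j := if F j != 0 then xi j else 0.
(* The blocks dropped in [y] contribute nothing to either product. *)
have -> : \mxrow_j F j *m \mxcol_j xi j = \mxrow_j F j *m \mxcol_j y j.
  rewrite !mul_mxrow_mxcol; apply: eq_bigr => j _; rewrite /y.
  by case: eqVneq => // ->; rewrite !mul0mx.
move=> /(loewner_qform _ _ _ (\mxcol_j y j)); rewrite -qform_mulmx.
rewrite qform_mxdiag => /le_trans; apply.
rewrite [leRHS]big_mkcond; apply: ler_sum => j _; rewrite /y qformZ.
by case: ifP => // _; rewrite qform0 mulr0.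
Qed.

End QuadraticForms.

(** Each term is [w j / a j] times [a j * v j], hence at most [w j / a j * m]. Since [m] is
    nonnegative, total weight below 1 is as good as total weight 1. *)
Lemma weighted_sum_le (R : realFieldType) (I : finType) (S : pred I)
    (w a v : I -> R) (m : R) :
  (forall j, S j -> 0 < a j) -> (forall j, 0 <= w j) -> 0 <= m ->
  \sum_(j | S j) w j / a j <= 1 -> (forall j, a j * v j <= m) ->
  \sum_(j | S j) w j * v j <= m.
Proof.
move=> a_gt0 w_ge0 m_ge0 sum_le1 av_le.
apply: (@le_trans _ _ (\sum_(j | S j) w j / a j * m)); last first.
  by rewrite -mulr_suml ler_piMl.
apply: ler_sum => j /a_gt0 aj_gt0.
rewrite -mulrA ler_wpM2l // mulrC ler_pdivlMr // mulrC.
exact: av_le.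
Qed.

Lemma trajectory_finite_step_feedback (R : realType) n m (A : 'M[R]_n)
    (B : 'M[R]_(n, m)) (K : 'M[R]_(m, n)) M (xi : 'cV[R]_n) l :
  (l <= M)%N ->
  trajectory A B xi (finite_step_feedback M (A + B *m K) K xi) l
    = (A + B *m K) ^+ l *m xi.
Proof.
elim: l => [|l IHl] lM /=; first by rewrite expr0 mul1mx.
(* Here [lM] says [l < M], so the input read at time [l] is the genuine entry [K *m AK ^+ l *m xi]
   and not the default 0. *)
rewrite (IHl (ltnW lM)) (nth_mktuple _ _ (Ordinal lM)) /=.
by rewrite exprS -[_ * _]/(_ *m _) !mulmxA -!mulmxDl.
Qed.

Lemma scalemx_mxdiag (R : pzRingType) ell (p : 'I_ell -> nat) (c : R)
    (D : forall j, 'M[R]_(p j)) :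
  c *: \mxdiag_j D j = \mxdiag_j (c *: D j).
Proof.
apply/mxblockP => j k; rewrite [in RHS]/mxdiag mxblockK.
have -> : submxblock (c *: \mxdiag_j D j) j k
  = c *: submxblock (\mxdiag_j D j) j k by apply/matrixP => s t; rewrite !mxE.
by rewrite mxblockK; case: eqVneq => [->|]; rewrite ?conform_mx_id ?scaler0.
Qed.

Lemma linear_matrix_inequality_mxdiag (R : realType) ell (p : 'I_ell -> nat)
    (S : 'M[R]_(\sum_j p j)%N) (P : forall j, 'M[R]_(p j)) :
  S^T = S -> (forall j, (P j)^T = P j) ->
  linear_matrix_inequality
    (fun tau : 'I_ell -> R => loewner S (\mxdiag_j (tau j *: P j))).
Proof.
move=> Ssym Psym.
(* The coefficient of [tau k] keeps only the [k]-th diagonal block; the constant term of the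
   inequality is [- S]. *)
pose D k := \mxdiag_j (if j == k then P j else 0).
exists (\sum_j p j)%N, (- S), D; split.
- by rewrite linearN /= Ssym.
- move=> k; rewrite tr_mxdiag; apply: eq_mxdiag => j.
  by case: ifP; rewrite ?Psym ?trmx0.
move=> tau; rewrite /loewner subr0 addrC.
suff -> : \sum_k tau k *: D k = \mxdiag_j (tau j *: P j) by [].
transitivity (\sum_k \mxdiag_j (tau k *: (if j == k then P j else 0))).
  by apply: eq_bigr => k _; rewrite scalemx_mxdiag.
rewrite -mxdiag_sum; apply: eq_mxdiag => j.
rewrite (bigD1 j) //= eqxx big1 ?addr0 // => k.
by rewrite eq_sym => /negPf->; rewrite scaler0.
Qed.

Lemma linear_inequality_sum (R : realType) ell (S : pred 'I_ell)
    (a : 'I_ell -> R) (d : R) :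
  linear_inequality (fun tau : 'I_ell -> R => \sum_(j | S j) tau j / a j <= d).
Proof.
(* The [a j] are fixed data, so their inverses serve as coefficients, extended by 0 outside [S]. *)
exists (fun j => if S j then (a j)^-1 else 0), d => tau.
rewrite big_mkcond; under [X in _ <-> X <= _]eq_bigr => j _.
  rewrite (_ : _ * _ = if S j then tau j / a j else 0).
    over.
  by case: ifP; rewrite ?mul0r // mulrC.
by [].
Qed.

Lemma linear_inequality_ge0 (R : realType) ell (j : 'I_ell) :
  linear_inequality (fun tau : 'I_ell -> R => 0 <= tau j).
Proof.
(* The condition is put in the form [- tau j <= 0]. *)
exists (fun k => - (k == j)%:R), 0 => tau.
rewrite (bigD1 j) //= eqxx mulN1r big1 ?addr0 ?oppr_le0 // => k /negPf->.
by rewrite oppr0 mul0r.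
Qed.

Lemma semidefinite_feasibility_nonneg (R : realType) ell
    (L H : ('I_ell -> R) -> Prop) :
  linear_matrix_inequality L -> linear_inequality H ->
  semidefinite_feasibility (fun tau : 'I_ell -> R =>
    [/\ forall j, 0 <= tau j, L tau & H tau]).
Proof.
move=> hL hH.
(* The [ell.+1] scalar constraints form one family: index [ord0] carries [H], and [lift ord0 j]
   carries the sign condition on [tau j]. *)
pose N (b : 'I_ell.+1) (tau : 'I_ell -> R) : Prop :=
  if unlift ord0 b is Some j then is_true (0 <= tau j) else H tau.
exists 1, ell.+1, (fun _ => L), N; split=> //.
  move=> b; rewrite /N; case: unliftP => [j _|_] //.
  exact: linear_inequality_ge0.
move=> tau; split=> [[tau_ge0 Lt Ht]|[Lt Nt]].
  by split=> // b; rewrite /N; case: unliftP.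
split; [|exact: Lt ord0|].
  by move=> j; move: (Nt (lift ord0 j)); rewrite /N liftK.
by move: (Nt ord0); rewrite /N unlift_none.
Qed.

Theorem proposition6 (R : realType) (ell : nat) (n m : 'I_ell -> nat)
    (A : 'M[R]_(\sum_j n j)%N)
    (B_ : forall j, 'M[R]_(n j, m j)) (K_ : forall j, 'M[R]_(m j, n j))
    (P : forall j, 'M[R]_(n j)) (hP : forall j, posdef (P j))
    (M : nat) (i : 'I_ell) (a : 'I_ell -> R) :
  let B := blkdiag B_ in
  let K := blkdiag K_ in
  let AK := A + B *m K in
  let Phi := fun j k : 'I_ell => submxblock (AK ^+ M) j k in
  let Phi_i := \mxrow_(j < ell) Phi i j in
  let W := fun (j : 'I_ell) (z : 'cV[R]_(n j)) => qform (P j) z in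
  let gamma := fun (j : 'I_ell) (s : R) => a j * s in
  let q := fun xi => finite_step_feedback M AK K xi in
  let x := fun (l : nat) xi (u : seq 'cV[R]_(\sum_j m j)%N) =>
    trajectory A B xi u l in
  let matrix_condition := fun tau : 'I_ell -> R =>
    loewner (Phi_i^T *m P i *m Phi_i) (\mxdiag_(j < ell) (tau j *: P j)) in
  let sum_condition := fun tau : 'I_ell -> R =>
    \sum_(j < ell | Phi i j != 0) tau j / a j <= 1 in
  (forall j, Phi i j != 0 -> 0 < a j) ->
  (forall j, Phi i j = 0 -> a j = 0) ->
  [/\ (exists tau : 'I_ell -> R,
         [/\ forall j, 0 <= tau j, matrix_condition tau & sum_condition tau]) ->
      forall xi : 'cV[R]_(\sum_j n j)%N,
        W i (submxcol (x M xi (q xi)) i)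
          <= \big[Num.max/gamma i (W i (submxcol xi i))]_(j < ell)
               gamma j (W j (submxcol xi j)),
      forall (xi : 'cV[R]_(\sum_j n j)%N) (l : nat), (l <= M)%N ->
        x l xi (q xi) = AK ^+ l *m xi,
      linear_matrix_inequality matrix_condition,
      linear_inequality sum_condition &
      semidefinite_feasibility (fun tau : 'I_ell -> R =>
        [/\ forall j, 0 <= tau j, matrix_condition tau & sum_condition tau])].
Proof.
move=> B K AK Phi Phi_i W gamma q x matrix_condition sum_condition a_gt0 a_eq0.
have P_sym j : (P j)^T = P j by case: (hP j).
have xE xi l : (l <= M)%N -> x l xi (q xi) = AK ^+ l *m xi.
  exact: trajectory_finite_step_feedback.
have lmi : linear_matrix_inequality matrix_condition.
  by apply: linear_matrix_inequality_mxdiag => //; rewrite !trmx_mul trmxK P_sym mulmxA.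
have lin : linear_inequality sum_condition.
  exact: (linear_inequality_sum _ _ (fun j => Phi i j != 0)).
split=> //; last exact: semidefinite_feasibility_nonneg.
case=> tau [tau_ge0 tau_mx tau_sum] xi.
(* Block [i] of [AK ^+ M *m xi] involves only the [i]-th block row of the power. *)
have -> : submxcol (x M xi (q xi)) i = Phi_i *m \mxcol_j submxcol xi j.
  rewrite xE // submxcolK -submxcol_mul; congr (_ *m _).
  apply/mxrowP => j; rewrite mxrowK.
  exact/esym/submxblockEv.
apply: (le_trans (qform_mxrow_le _ _ _ _ _ _ _ _ _ tau_mx)).
apply: (weighted_sum_le _ _ (fun j => Phi i j != 0) _ a) => //.
  (* The maximum is at least its default value, the entry at [i]. That entry is nonnegative: [a i]
     is positive or 0 according to whether [Phi i i] is nonzero. *)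
  apply: le_trans (bigmax_ge_id _ _ _ _); rewrite /gamma mulr_ge0 ?posdef_ge0 //.
  by have [/a_eq0-> | /a_gt0/ltW] := eqVneq (Phi i i) 0.
move=> j; exact: (le_bigmax _ (fun j => gamma j (W j (submxcol xi j)))).
Qed.
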